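(* Let $\Sigma$ be an alphabet, let $(I,O)$ be an IO signature of $\Sigma$, and let $A_1,A_2$ be $I$-interface automata. Then $A_1\le A_2$ if and only if $\mathcal{C}_{A_1}\le\mathcal{C}_{A_2}$, i.e. refinement of the interface automata is equivalent to refinement of their associated interface hypercontracts.
   Context: An IO signature $(I,O)$ of an alphabet $\Sigma$ is a partition of $\Sigma$ into two disjoint (possibly empty) sets. A language $L\subseteq\Sigma^*$ is $I$-receptive if it is nonempty, prefix-closed, and for all $w\in L$, $w'\in I^*$ one has $w\circ w'\in L$ ($\circ$ is concatenation, of words and of languages). $\mathcal{L}_I$ is the set of $I$-receptive languages; $\mathcal{L}_\emptyset$ is the set of nonempty prefix-closed languages. Interface automata. An $I$-interface automaton is a tuple $A=(Q,q_0,\to)$ with $Q$ a finite set of states, $q_0\in Q$ the initial state, and $\to\ \subseteq Q\times\Sigma\times Q$ a deterministic transition relation (for each state and symbol there is at most one next state); write $q\xrightarrow{\sigma}q'$ for $(q,\sigma,q')\in\to$. For $I$-interface automata $A_i=(Q_i,q_{i,0},\to_i)$, $i\in\{1,2\}$, refinement of states is the coinductively defined (largest) relation $\le$ between $Q_1$ and $Q_2$ such that $q_1\le q_2$ implies: (1) for all $\sigma\in O$, $q_1'\in Q_1$: if $q_1\xrightarrow{\sigma}_1 q_1'$ then there is $q_2'\in Q_2$ with $q_2\xrightarrow{\sigma}_2 q_2'$ and $q_1'\le q_2'$; and (2) for all $\sigma\in I$, $q_2'\in Q_2$: if $q_2\xrightarrow{\sigma}_2 q_2'$ then there is $q_1'\in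 Q_1$ with $q_1\xrightarrow{\sigma}_1 q_1'$ and $q_1'\le q_2'$. $A_1\le A_2$ means $q_{1,0}\le q_{2,0}$. The language $\ell(A)\in\mathcal{L}_\emptyset$ of $A$ is the set of all words (including the empty word) labelling a finite path of transitions starting at $q_0$. Associated hypercontract. For a language $S$ and $\Gamma\subseteq\Sigma$ let $\mathrm{MissExt}(S,S,\Gamma)=\big((S\circ\Gamma)\setminus S\big)\circ\Sigma^*$. For an $I$-interface automaton $A$, put $S=\ell(A)$, $E_S=S\cup\mathrm{MissExt}(S,S,O)\in\mathcal{L}_O$ and $M_S=S\cup\mathrm{MissExt}(S,S,I)\in\mathcal{L}_I$. The interface hypercontract $\mathcal{C}_A$ has environments $\{E\in\mathcal{L}_O : E\subseteq E_S\}$, closed-system specification $\{N\in\mathcal{L}_\emptyset : N\subseteq S\}$, and implementations $\{M\in\mathcal{L}_I : M\subseteq M_S\}$. Refinement $\mathcal{C}\le\mathcal{C}'$ means that every environment of $\mathcal{C}'$ is an environment of $\mathcal{C}$ and every implementation of $\mathcal{C}$ is an implementation of $\mathcal{C}'$. *)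

(* Defs.v *)
From mathcomp Require Import all_boot.
From mathcomp Require Import boolp classical_sets.

Set Implicit Arguments.
Unset Strict Implicit.
Unset Printing Implicit Defensive.

Local Open Scope classical_set_scope.

(* The alphabet is an arbitrary type, finite or not; words are sequences over
   it and languages are (classical) sets of words. *)
Notation language Sigma := (set (seq Sigma)).

Record io_signature (Sigma : Type) := IOSignature {
  inputs : set Sigma;
  outputs : set Sigma;
  io_disjoint : inputs `&` outputs = set0;
  io_cover : inputs `|` outputs = setT }.

Section Languages.
Variable Sigma : Type.
Implicit Types (L K S : language Sigma) (G : set Sigma).

Definition concat L K : language Sigma := [set u ++ v | u in L & v in K].

Definition letters G : language Sigma := [set [:: a] | a in G].

(* The Kleene star G^*; in particular [star setT] is Sigma^*. *)
Definition star G : language Sigma := [set w | all (mem G) w].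

Definition prefix_closed L := forall u v, L (u ++ v) -> L u.

Definition receptive G : set (language Sigma) :=
  [set L | [/\ L !=set0, prefix_closed L &
               forall w w', L w -> star G w' -> L (w ++ w')]].

(* MissExt(S, S, G) = ((S o G) \ S) o Sigma^*, with G read as a set of
   one-letter words. *)
Definition miss_ext S G : language Sigma :=
  concat (concat S (letters G) `\` S) (star setT).

End Languages.

(* The transition structure does not depend on the signature; the parameter [s]
   only records with respect to which signature refinement and the associated
   hypercontract are taken. *)
Record interface_automaton (Sigma : Type) (s : io_signature Sigma) :=
  InterfaceAutomaton {
    state : finType;
    init : state;
    trans : state -> Sigma -> state -> Prop;
    trans_det : forall q a q1 q2, trans q a q1 -> trans q a q2 -> q1 = q2 }.

Section Automata.
Variables (Sigma : Type) (s : io_signature Sigma).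
Implicit Types A : interface_automaton s.

CoInductive state_refines A1 A2 (q1 : state A1) (q2 : state A2) : Prop :=
  StateRefines of
      (forall a q1', outputs s a -> trans q1 a q1' ->
         exists2 q2', trans q2 a q2' & state_refines q1' q2')
    & (forall a q2', inputs s a -> trans q2 a q2' ->
         exists2 q1', trans q1 a q1' & state_refines q1' q2').

Definition automaton_refines A1 A2 := state_refines (init A1) (init A2).

Fixpoint run A (q : state A) (w : seq Sigma) (q' : state A) : Prop :=
  if w is a :: w' then exists2 r, trans q a r & run r w' q' else q = q'.

Definition lang A : language Sigma := [set w | exists q, run (init A) w q].

End Automata.

Record hypercontract (Sigma : Type) := Hypercontract {
  environments : set (language Sigma);
  closed_systems : set (language Sigma);
  implementations : set (language Sigma) }.

Definition hypercontract_refines (Sigma : Type) (C C' : hypercontract Sigma) :=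
  environments C' `<=` environments C /\
  implementations C `<=` implementations C'.

Section InterfaceHypercontract.
Variables (Sigma : Type) (s : io_signature Sigma) (A : interface_automaton s).

Definition max_environment : language Sigma :=
  lang A `|` miss_ext (lang A) (outputs s).

Definition max_implementation : language Sigma :=
  lang A `|` miss_ext (lang A) (inputs s).

Definition interface_hypercontract : hypercontract Sigma := {|
  environments := [set E | receptive (outputs s) E /\ E `<=` max_environment];
  closed_systems := [set N | receptive set0 N /\ N `<=` lang A];
  implementations :=
    [set M | receptive (inputs s) M /\ M `<=` max_implementation] |}.

End InterfaceHypercontract.

(* Main.v *)
(* The maximal environment and the maximal implementation of an automaton both
   have the shape S `|` miss_ext S G: the words that leave S, if ever, through a
   letter of G.  They are themselves receptive, so refinement of the hypercontracts
   amounts to the inclusion of these maximal elements.  Both this and refinement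
   of the automata are equivalent to the following condition: after a common
   word of the two languages, outputs enabled in A1 are enabled in A2, and inputs
   enabled in A2 are enabled in A1. *)
From mathcomp Require Import all_boot.
From mathcomp Require Import boolp classical_sets.
Require Import Defs.

Set Implicit Arguments.
Unset Strict Implicit.
Unset Printing Implicit Defensive.

Local Open Scope classical_set_scope.

Section MissingExtensions.
Variable Sigma : Type.
Implicit Types (S T L : language Sigma) (G H : set Sigma).

Lemma prefix_closed_rcons S u a : prefix_closed S -> S (rcons u a) -> S u.
Proof. by move=> Spc; rewrite -cats1; apply: Spc. Qed.

Lemma first_exitP S w : S [::] ->
  S w \/ exists u a v, [/\ w = rcons u a ++ v, S u & ~ S (rcons u a)].
Proof.
move=> S0; elim/last_ind: w => [|w a [Sw|[u [b [v [-> Su Sub]]]]]]; first by left.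
  have [?|nSwa] := pselect (S (rcons w a)); first by left.
  by right; exists w, a, [::]; rewrite cats0.
by right; exists u, b, (rcons v a); rewrite rcons_cat.
Qed.

(** Prefix closure makes the prefixes of a word that lie in [S] an initial segment, so the place
    where the word leaves [S] is unique. *)
Lemma exit_unique S x b z u a v : prefix_closed S ->
    S x -> ~ S (rcons x b) -> S u -> ~ S (rcons u a) ->
  rcons x b ++ z = rcons u a ++ v -> b = a.
Proof.
move=> Spc; rewrite -!cats1 -!catA /=.
elim: x u S Spc => [|c x IHx] [|d u] S Spc /= Sx nSxb Su nSua.
- by case.
- by case=> bd _; case: nSxb; rewrite bd; apply: (Spc [:: d] u).
- by case=> ca _; case: nSua; rewrite -ca; apply: (Spc [:: c] x).
- case=> cd; rewrite -cd in Su nSua.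
  (* The shared first letter is removed by passing to the left quotient of [S] by [c], which is
     again prefix-closed. *)
  apply: (IHx u [set w | S (c :: w)]) => // p q.
  exact: (Spc (c :: p) q).
Qed.

Lemma star_setT (w : seq Sigma) : star setT w.
Proof. by rewrite /star /=; elim: w => //= a w ->; rewrite in_setT. Qed.

(** Since the exit from [S] is unique, quantifying over all exits is the same as speaking of the
    only one. The universal form also covers words of [S], where it is vacuous, and spares later
    proofs the concatenations in [miss_ext]. *)
Lemma miss_ext_closureP S G w : prefix_closed S -> S [::] ->
  (S `|` miss_ext S G) w <->
  forall u a v, w = rcons u a ++ v -> S u -> ~ S (rcons u a) -> G a.
Proof.
move=> Spc S0; split.
  move=> [Sw u a v wE _ []|]; first by apply: (Spc _ v); rewrite -wE.
  move=> [_ [[x Sx [_ [b Gb <-] <-]] nSxb] [z _ <-]] u a v.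
  rewrite cats1 in nSxb *.
  by move=> E Su nSua; rewrite -(exit_unique Spc Sx nSxb Su nSua E).
move=> exitG; have [|[u [a [v [wE Su nSua]]]]] := first_exitP w S0; first by left.
right; exists (rcons u a); last by exists v => //; apply: star_setT.
split=> //; exists u => //; exists [:: a]; last by rewrite cats1.
by exists a => //; apply: (exitG _ _ _ wE).
Qed.

(** When a letter of [G] is appended, the exit is either that letter or an exit of the shorter
    word. *)
Lemma miss_ext_closure_receptive S G : prefix_closed S -> S [::] ->
  receptive G (S `|` miss_ext S G).
Proof.
move=> Spc S0; split; first by exists [::]; left.
  move=> u v /(miss_ext_closureP _ _ Spc S0) uvG.
  apply/(miss_ext_closureP _ _ Spc S0) => x a z uE.
  by apply: (uvG _ _ (z ++ v)); rewrite uE catA.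
move=> w w'; elim: w' w => [|a w' IHw] w; first by rewrite cats0.
move=> wG /= /andP[]; rewrite inE => Ga w'G; rewrite -cat_rcons; apply: IHw => //.
move: wG => /(miss_ext_closureP _ _ Spc S0) wG.
apply/(miss_ext_closureP _ _ Spc S0) => u b v.
case/lastP: v => [|v c]; first by rewrite cats0 => /rcons_inj[_ <-].
by rewrite -rcons_cat => /rcons_inj[wE _]; apply: wG wE.
Qed.

(** Prefixes of [w] lying in [T] also lie in [S]: a first exit from [S] would use a letter of [G],
    which the last hypothesis forbids. So where [w] leaves [T], either it leaves [S] too, through
    [G], or it stays in [S], and then the letter cannot be in [H]. *)
Lemma miss_ext_closure_sub S T G H :
    prefix_closed S -> S [::] -> prefix_closed T -> T [::] ->
    G `|` H = setT ->
    (forall u a, S u -> T u -> H a -> S (rcons u a) -> T (rcons u a)) ->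
    (forall u a, S u -> T u -> G a -> T (rcons u a) -> S (rcons u a)) ->
  S `|` miss_ext S G `<=` T `|` miss_ext T G.
Proof.
move=> Spc S0 Tpc T0 GH HST GTS w /(miss_ext_closureP _ _ Spc S0) wG.
apply/(miss_ext_closureP _ _ Tpc T0) => u a v wE Tu nTua.
have Su : S u.
  (* Only the fact that [u] is a prefix of [w] is kept, as the exit letter [a] does not survive the
     induction on [u]. *)
  have : exists z, w = u ++ z by exists (a :: v); rewrite -cat_rcons.
  elim/last_ind: u Tu {wE nTua} => // u b IHu Tub [z wE].
  have Tu := prefix_closed_rcons Tpc Tub.
  have Su : S u by apply: IHu => //; exists (b :: z); rewrite -cat_rcons.
  have [//|nSub] := pselect (S (rcons u b)).
  by apply: GTS => //; apply: wG wE Su nSub.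
have [Sua|nSua] := pselect (S (rcons u a)); last exact: wG wE Su nSua.
have : (G `|` H) a by rewrite GH.
by case=> // Ha; case: nTua; apply: HST.
Qed.

(** Otherwise [a] would be the exit letter of [rcons u a] from [T], hence in both [G] and [H]. *)
Lemma miss_ext_closure_sub_rcons S T G H u a :
    prefix_closed T -> T [::] -> G `&` H = set0 ->
    S `|` miss_ext S G `<=` T `|` miss_ext T G ->
  T u -> H a -> S (rcons u a) -> T (rcons u a).
Proof.
move=> Tpc T0 GH sub Tu Ha Sua; apply: contrapT => nTua.
have /(miss_ext_closureP _ _ Tpc T0) uaG := sub _ (or_introl Sua).
have Ga : G a by apply: (uaG u a [::]) => //; rewrite cats0.
suff : set0 a by [].
by rewrite -GH.
Qed.

End MissingExtensions.

Section Runs.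
Variables (Sigma : Type) (s : io_signature Sigma).
Implicit Types A : interface_automaton s.

Lemma run_cat A (q r : state A) u v :
  run q (u ++ v) r <-> exists2 p, run q u p & run p v r.
Proof.
elim: u q => [|a u IHu] q /=; first by split=> [|[_ ->]//]; exists q.
split=> [[p qp /IHu[p' pp' p'r]]|[p' [p qp pp'] p'r]].
  by exists p' => //; exists p.
by exists p => //; apply/IHu; exists p'.
Qed.

Lemma run_rcons A (q r : state A) u a :
  run q (rcons u a) r <-> exists2 p, run q u p & trans p a r.
Proof.
rewrite -cats1 run_cat; split=> [[p qp [? pr <-]]|[p qp pr]]; first by exists p.
by exists p => //; exists r.
Qed.

Lemma run_det A (q r r' : state A) u : run q u r -> run q u r' -> r = r'.
Proof.
elim: u q => [|a u IHu] q /=; first by move=> <- <-.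
by move=> [p qp pr] [p' /(trans_det qp) <-]; apply: IHu.
Qed.

Lemma lang_nil A : lang A [::].
Proof. by exists (init A). Qed.

Lemma lang_prefix_closed A : prefix_closed (lang A).
Proof. by move=> u v [r /run_cat[p ? _]]; exists p. Qed.

Lemma lang_rcons A (q : state A) u a : run (init A) u q ->
  lang A (rcons u a) <-> exists r, trans q a r.
Proof.
move=> uq; split=> [[r /run_rcons[p up pr]]|[r qr]].
  by exists r; rewrite (run_det uq up).
by exists r; apply/run_rcons; exists q.
Qed.

(** By determinism, the matching successor supplied by refinement is the state that the given run
    visits. *)
Lemma state_refines_run A1 A2 (q1 r1 : state A1) (q2 r2 : state A2) u :
  state_refines q1 q2 -> run q1 u r1 -> run q2 u r2 -> state_refines r1 r2.
Proof.
elim: u q1 q2 => [|a u IHu] q1 q2 /=; first by move=> q12 <- <-.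
move=> [outs ins] [p1 qp1 pr1] [p2 qp2 pr2].
suff p12 : state_refines p1 p2 by apply: IHu p12 pr1 pr2.
have : (inputs s `|` outputs s) a by rewrite io_cover.
case=> [Ia|Oa].
  by have [p /(trans_det qp1) <-] := ins _ _ Ia qp2.
by have [p /(trans_det qp2) <-] := outs _ _ Oa qp1.
Qed.

Definition lang_refines A1 A2 :=
  (forall u a, lang A1 u -> lang A2 u -> outputs s a ->
     lang A1 (rcons u a) -> lang A2 (rcons u a)) /\
  (forall u a, lang A1 u -> lang A2 u -> inputs s a ->
     lang A2 (rcons u a) -> lang A1 (rcons u a)).

Lemma state_refines_coind A1 A2 (R : state A1 -> state A2 -> Prop) :
    (forall q1 q2 a r1, R q1 q2 -> outputs s a -> trans q1 a r1 ->
       exists2 r2, trans q2 a r2 & R r1 r2) ->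
    (forall q1 q2 a r2, R q1 q2 -> inputs s a -> trans q2 a r2 ->
       exists2 r1, trans q1 a r1 & R r1 r2) ->
  forall q1 q2, R q1 q2 -> state_refines q1 q2.
Proof.
move=> outs ins; cofix CIH => q1 q2 Rq; split=> a r aP qr.
  by case: (outs _ _ _ _ Rq aP qr) => r2 qr2 Rr; exists r2 => //; apply: CIH.
by case: (ins _ _ _ _ Rq aP qr) => r1 qr1 Rr; exists r1 => //; apply: CIH.
Qed.

Lemma lang_refines_state A1 A2 :
  lang_refines A1 A2 -> automaton_refines A1 A2.
Proof.
move=> [outs ins].
(* The simulation relates states reached by a common word; determinism makes enabledness there a
   property of the languages. *)
pose R (q1 : state A1) (q2 : state A2) :=
  exists2 u, run (init A1) u q1 & run (init A2) u q2.
have Rtrans q1 q2 a r1 r2 : R q1 q2 -> trans q1 a r1 -> trans q2 a r2 -> R r1 r2.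
  move=> [u uq1 uq2] qr1 qr2.
  by exists (rcons u a); apply/run_rcons; [exists q1 | exists q2].
apply: (@state_refines_coind _ _ R); last by exists [::].
  move=> q1 q2 a r1 Rq Oa qr1; have [u uq1 uq2] := Rq.
  have /(lang_rcons _ uq2)[r2 qr2] : lang A2 (rcons u a).
    apply: outs => //; [by exists q1 | by exists q2 |].
    by apply/(lang_rcons _ uq1); exists r1.
  by exists r2 => //; apply: Rtrans qr1 qr2.
move=> q1 q2 a r2 Rq Ia qr2; have [u uq1 uq2] := Rq.
have /(lang_rcons _ uq1)[r1 qr1] : lang A1 (rcons u a).
  apply: ins => //; [by exists q1 | by exists q2 |].
  by apply/(lang_rcons _ uq2); exists r2.
by exists r1 => //; apply: Rtrans qr1 qr2.
Qed.

Lemma automaton_refinesP A1 A2 : automaton_refines A1 A2 <-> lang_refines A1 A2.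
Proof.
split=> [ref|]; last exact: lang_refines_state.
split=> u a [q1 uq1] [q2 uq2] aP;
  have [outs ins] := state_refines_run ref uq1 uq2.
- move=> /(lang_rcons _ uq1)[r1 /(outs _ _ aP)[r2 qr2 _]].
  by apply/(lang_rcons _ uq2); exists r2.
- move=> /(lang_rcons _ uq2)[r2 /(ins _ _ aP)[r1 qr1 _]].
  by apply/(lang_rcons _ uq1); exists r1.
Qed.

Lemma hypercontract_refines_max A1 A2 :
  hypercontract_refines (interface_hypercontract A1) (interface_hypercontract A2)
  <-> max_environment A2 `<=` max_environment A1 /\
      max_implementation A1 `<=` max_implementation A2.
Proof.
have rec A G : receptive G (lang A `|` miss_ext (lang A) G).
  exact: miss_ext_closure_receptive (@lang_prefix_closed A) (lang_nil A).
split=> -[envs impls]; split.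
- by have [|] := envs (max_environment A2); first by split=> //; apply: rec.
- by have [|] := impls (max_implementation A1); first by split=> //; apply: rec.
- by move=> E [? /subset_trans]; split=> //; auto.
- by move=> M [? /subset_trans]; split=> //; auto.
Qed.

End Runs.

Theorem proposition8 (Sigma : Type) (s : io_signature Sigma)
    (A1 A2 : interface_automaton s) :
  automaton_refines A1 A2 <->
  hypercontract_refines (interface_hypercontract A1)
                        (interface_hypercontract A2).
Proof.
rewrite automaton_refinesP hypercontract_refines_max.
have pc := @lang_prefix_closed _ s; have nil := @lang_nil _ s.
split=> -[].
  move=> outs ins; split.
    (* For environments the inclusion goes from [A2] to [A1] with [G] the outputs; for
       implementations it goes from [A1] to [A2] with [G] the inputs. *)
    by apply: (@miss_ext_closure_sub _ _ _ _ (inputs s)) => //;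
      [rewrite setUC io_cover | move=> *; apply: ins | move=> *; apply: outs].
  by apply: (@miss_ext_closure_sub _ _ _ _ (outputs s)) => //; apply: io_cover.
move=> envs impls; split=> u a u1 u2.
  (* Implementations may exit only through inputs, so their inclusion controls outputs; dually,
     environments control inputs. *)
  exact: miss_ext_closure_sub_rcons (pc A2) (nil A2) (io_disjoint s) impls u2.
apply: miss_ext_closure_sub_rcons (pc A1) (nil A1) _ envs u1.
by rewrite setIC io_disjoint.
Qed.
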